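(* Let $f\in\mathcal{F}_{\mu,L}$ with $0<\mu\le L$ and minimizer $x^*$, and let $0<s\le 1/L$. With the choice $m=\sqrt{s}$, $q=\sqrt{\mu}$, $n=2\sqrt{\mu}$, $p=1/\sqrt{\mu}$, the system $$\dot{X}_t=-m\nabla f(X_t)-n(X_t-V_t),\qquad \dot{V}_t=-p\nabla f(X_t)-q(V_t-X_t),\qquad t\ge 0,$$ reduces to the ODE $$\ddot{X}_t+3\sqrt{\mu}\,\dot{X}_t+\sqrt{s}\,\nabla^2 f(X_t)\dot{X}_t+(2+\sqrt{s\mu})\nabla f(X_t)=0 .$$ Furthermore, its trajectories satisfy $$f(X_t)-f(x^* )\le C'_{TM}\,e^{-2\sqrt{\mu}\,t},\qquad t\ge 0,$$ where $C'_{TM}$ is a positive constant.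
   Context: $\mathcal{F}_{\mu,L}$ is the class of functions $f:\mathbb{R}^d\to\mathbb{R}$ that are $\mu$-strongly convex and $L$-smooth (the gradient is $L$-Lipschitz). Dots denote time derivatives; when the Hessian appears, $f$ is understood to be twice continuously differentiable. ''Reduces to'' means that eliminating $V_t$ from the first-order system yields the displayed second-order ODE for $X_t$. The constant $C'_{TM}$ does not depend on $t$ (it may depend on the initial data and the parameters). *)

(* Defs.v *)
From mathcomp Require Export all_boot all_order all_algebra.
From mathcomp Require Export all_classical all_reals all_analysis.

Set Implicit Arguments.
Unset Strict Implicit.
Unset Printing Implicit Defensive.

Import Order.TTheory GRing.Theory Num.Theory.
Import numFieldNormedType.Exports.

Local Open Scope classical_set_scope.
Local Open Scope ring_scope.

(* The library norm on ['rV[R]_d] is the sup norm; the constants mu and L refer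
   to this Euclidean norm. *)
Definition enorm (R : realType) (d : nat) (v : 'rV[R]_d) : R :=
  Num.sqrt (\sum_(i < d) v 0 i ^+ 2).

Definition gradient (R : realType) (d : nat) (f : 'rV[R]_d -> R) (x : 'rV[R]_d)
    : 'rV[R]_d :=
  \row_(i < d) 'D_(delta_mx 0 i) f x.

(* Entry (i, j) is the i-th partial derivative of the j-th partial derivative.
   Vectors are rows, so the Hessian applied to v is [v *m hessian f x]. *)
Definition hessian (R : realType) (d : nat) (f : 'rV[R]_d -> R) (x : 'rV[R]_d)
    : 'M[R]_d :=
  jacobian (gradient f) x.

Definition strongly_convex (R : realType) (d : nat) (mu : R)
    (f : 'rV[R]_d -> R) : Prop :=
  forall (x y : 'rV[R]_d) (a : R), 0 <= a -> a <= 1 ->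
    f (a *: x + (1 - a) *: y) <=
      a * f x + (1 - a) * f y - mu / 2 * a * (1 - a) * enorm (x - y) ^+ 2.

Definition smooth (R : realType) (d : nat) (L : R) (f : 'rV[R]_d -> R) : Prop :=
  (forall x, differentiable f x) /\
  (forall x y, enorm (gradient f x - gradient f y) <= L * enorm (x - y)).

Definition F_class (R : realType) (d : nat) (mu L : R) (f : 'rV[R]_d -> R)
    : Prop :=
  strongly_convex mu f /\ smooth L f.

Definition twice_continuously_differentiable (R : realType) (d : nat)
    (f : 'rV[R]_d -> R) : Prop :=
  [/\ forall x, differentiable f x,
      forall x, differentiable (gradient f) x
    & continuous (hessian f)].

Definition minimizer (R : realType) (d : nat) (f : 'rV[R]_d -> R)
    (xs : 'rV[R]_d) : Prop :=
  forall x, f xs <= f x.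

(* Derivative of a curve defined on [0, +oo[: two-sided at t > 0, right
   derivative at t = 0. Values of Y at negative times play no role. *)
Definition has_time_derivative (R : realType) (d : nat) (Y : R -> 'rV[R]_d)
    (t : R) (v : 'rV[R]_d) : Prop :=
  h^-1 *: (Y (t + h) - Y t) @[h --> within [set h : R | 0 <= t + h] 0^'] --> v.

Definition first_order_system (R : realType) (d : nat) (f : 'rV[R]_d -> R)
    (m n p q : R) (X V : R -> 'rV[R]_d) : Prop :=
  forall t : R, 0 <= t ->
    has_time_derivative X t (- (m *: gradient f (X t)) - n *: (X t - V t)) /\
    has_time_derivative V t (- (p *: gradient f (X t)) - q *: (V t - X t)).

Definition second_order_ODE (R : realType) (d : nat) (f : 'rV[R]_d -> R)
    (mu s : R) (X : R -> 'rV[R]_d) : Prop :=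
  exists X' X'' : R -> 'rV[R]_d, forall t : R, 0 <= t ->
    [/\ has_time_derivative X t (X' t),
        has_time_derivative X' t (X'' t)
      & X'' t + (3 * Num.sqrt mu) *: X' t
          + Num.sqrt s *: (X' t *m hessian f (X t))
          + (2 + Num.sqrt (s * mu)) *: gradient f (X t) = 0].

(* Main.v *)
Require Import Defs.
From mathcomp Require Import ring lra.
Import Order.TTheory GRing.Theory Num.Theory.
Import numFieldNormedType.Exports.
Local Open Scope classical_set_scope.
Local Open Scope ring_scope.

(** Equivalence of the first- and second-order forms. The first equation of the
system is solved for the auxiliary curve,
[V = X + (X' + sqrt s *: grad f X) / (2 sqrt mu)]; substituting this into the
second equation turns the system into the second-order equation and back, the
Hessian term being the derivative of [grad f X] along the trajectory
([first_order_second_order], [second_order_first_order]).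

Decay. Write [q = sqrt mu], [x = X - xs], [v = V - xs] and [g = grad f X]. The
Lyapunov function is [E = f X - f xs - mu/2 |x|^2 + mu |v|^2]. Subtracting
[mu/2 |x|^2] is what doubles the usual rate [q]: the function
[h = f - f xs - mu/2 |. - xs|^2] is still convex and nonnegative, and [V]
satisfies [V' = - grad h (X) / q - q v], so that the energy [mu |v|^2] decays at
rate [2 q] by itself. The cross terms [<g, v>] and [<x, v>] cancel, which leaves
[E' <= - 2 q E] by the gradient inequality for [h] ([energy_decay]).

Since [E] no longer controls [|x|^2], a second estimate is needed to come back
to [f]. Both [h] and [mu |v|^2] are nonnegative, so [|v|^2] decays at rate
[2 q]; the equation for [X] is a damped linear equation forced by [v], whose
damping rate [3 q] for [|x|^2] (after absorbing the forcing by Young's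
inequality) exceeds [2 q], so [|x|^2] also decays at rate [2 q]
([position_decay]). Adding [mu/2 |x|^2] to the bound on [E] gives the theorem.

Derivatives at time [0] are one-sided in the statement. Every solution on
[[0, +oo[] is prolonged affinely to negative times, which makes all derivatives
two-sided ([has_time_derivative_extend]) without affecting any value at
nonnegative times. *)

(** * Derivatives of curves on the half-line *)

(** The textbook quotient [Z (t + h) - Z t] replaces the [h *: 1] and [shift] of
the general directional derivative; it is the form used by
[has_time_derivative]. *)
Lemma is_derive_cvgP {R : realType} {W : normedModType R} (Z : R -> W)
    (t : R) (v : W) :
  is_derive t 1 Z v <-> h^-1 *: (Z (t + h) - Z t) @[h --> 0^'] --> v.
Proof.
have -> : (fun h : R => h^-1 *: (Z (t + h) - Z t)) =
          (fun h : R => h^-1 *: ((Z \o shift t) (h *: 1) - Z t)).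
  by apply/funext => h; rewrite /= /GRing.scale/= mulr1 (addrC t).
split=> [[dZ <-]|Zv]; first exact: dZ.
by apply: DeriveDef; [apply/cvg_ex; exists v | exact: cvg_lim].
Qed.

Lemma has_time_derivative_restrict {R : realType} {d : nat}
    {Y Z : R -> 'rV[R]_d} {t : R} {v : 'rV[R]_d} :
  (forall u : R, 0 <= u -> Z u = Y u) -> 0 <= t -> is_derive t 1 Z v ->
  has_time_derivative Y t v.
Proof.
move=> ZY t0 /is_derive_cvgP Zv A /Zv; rewrite /= /nbhs/= /within/= => ZA.
by apply: filterS ZA => h /= + th; rewrite !ZY.
Qed.

(** Prolonging [Y] to negative times by its tangent line at [0] makes the left
difference quotient at [0] constant, equal to the right derivative. The two-sided
calculus then applies at every [t >= 0], including the endpoint. *)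
Lemma has_time_derivative_extend {R : realType} {d : nat}
    {Y Y' : R -> 'rV[R]_d} :
  (forall t : R, 0 <= t -> has_time_derivative Y t (Y' t)) ->
  exists Z : R -> 'rV[R]_d, (forall u : R, 0 <= u -> Z u = Y u) /\
    (forall t : R, 0 <= t -> is_derive t 1 Z (Y' t)).
Proof.
move=> dY; pose Z u := if 0 <= u then Y u else Y 0 + u *: Y' 0.
have ZY u : 0 <= u -> Z u = Y u by rewrite /Z => ->.
exists Z; split=> // t t0; apply/is_derive_cvgP => A YA.
have YtA : \forall h \near 0^', 0 <= t + h -> A (h^-1 *: (Y (t + h) - Y t)).
  exact: dY t t0 A YA.
suff : \forall h \near 0^', A (h^-1 *: (Z (t + h) - Z t)) by [].
(* A negative time t + h occurs for arbitrarily small h only when t = 0. *)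
have t00 : \forall h \near 0^', t + h < 0 -> t = 0.
  move: t0; rewrite le_eqVlt => /predU1P[<-|t_gt0]; first exact: nearW.
  near=> h; have : `|h| < t by near: h; exact: dnbhs0_lt.
  by rewrite ltr_norml => /andP[]; lra.
rewrite (ZY t)//; near=> h.
have [th|th] := leP 0 (t + h).
  by rewrite ZY//; move: th; near: h.
have tE : t = 0 by move: th; near: h.
move: th; rewrite tE add0r => h0.
(* At t = 0 with h < 0, the quotient is that of the tangent line. *)
rewrite /Z leNgt h0 /= addrC addKr scalerA mulVf ?lt_eqF// scale1r.
by rewrite -tE; exact: nbhs_singleton.
Unshelve. all: by end_near. Qed.

Lemma is_derive_curve_comp {R : realType} {V W : normedModType R}
    {F : V -> W} {Z : R -> V} {t : R} {v : V} :
  differentiable F (Z t) -> is_derive t 1 Z v ->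
  is_derive t 1 (F \o Z) ('d F (Z t) v).
Proof.
move=> dF [/derivable1_diffP dZ Zv].
have dFZ := differentiable_comp dZ dF.
apply: DeriveDef; first exact/derivable1_diffP.
by rewrite deriveE// diff_comp//= -Zv deriveE.
Qed.

Lemma is_derive_expRM {R : realType} (c t : R) :
  is_derive t 1 (fun u : R => expR (c * u)) (expR (c * t) * c).
Proof.
apply: (@is_derive1_comp _ expR (fun u => c * u)).
apply: is_derive_eq (is_deriveZ c (is_derive_id t 1)) _.
exact: mulr1.
Qed.

(** The product [expR (c * t) * E t] has a nonpositive derivative. *)
Lemma gronwall {R : realType} {c : R} {E E' : R -> R} :
  (forall t : R, 0 <= t -> is_derive t 1 E (E' t)) ->
  (forall t : R, 0 <= t -> E' t <= - c * E t) ->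
  forall t : R, 0 <= t -> E t <= E 0 * expR (- (c * t)).
Proof.
move=> dE leE t t0.
pose G (u : R) := expR (c * u) * E u.
have dG (u : R) : 0 <= u -> is_derive u 1 G (expR (c * u) * (E' u + c * E u)).
  move=> u0.
  apply: is_derive_eq (is_deriveM (is_derive_expRM c u) (dE u u0)) _.
  by rewrite /GRing.scale/=; ring.
have dG0 (x : R) : x \in `]0, t[ -> 0 <= x by rewrite in_itv/= => /andP[/ltW].
have : G t <= G 0.
  apply: (@ler0_derive1_le_cc _ _ 0 t); rewrite ?in_itv/= ?lexx ?t0//.
  - by move=> x /dG0 /dG[].
  - move=> x /dG0 x0; rewrite derive1E; have [_ ->] := dG x x0.
    rewrite mulr_ge0_le0 ?expR_ge0//; have := leE x x0; lra.
  - apply: derivable_within_continuous => x; rewrite in_itv/= => /andP[x0 _].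
    by have [] := dG x x0.
by rewrite /G mulr0 expR0 mul1r expRN -ler_pdivlMl ?expR_gt0// mulrC.
Qed.

(** * Euclidean inner product *)

Definition dotr {R : realType} {d : nat} (u v : 'rV[R]_d) : R :=
  \sum_(i < d) u 0 i * v 0 i.

Lemma dotrC {R : realType} {d : nat} (u v : 'rV[R]_d) : dotr u v = dotr v u.
Proof. by apply: eq_bigr => i _; rewrite mulrC. Qed.

Lemma dotrDl {R : realType} {d : nat} (u v w : 'rV[R]_d) :
  dotr (u + v) w = dotr u w + dotr v w.
Proof.
by rewrite /dotr -big_split; apply: eq_bigr => i _; rewrite mxE mulrDl.
Qed.

Lemma dotrZl {R : realType} {d : nat} (a : R) (u w : 'rV[R]_d) :
  dotr (a *: u) w = a * dotr u w.
Proof. by rewrite /dotr mulr_sumr; apply: eq_bigr => i _; rewrite mxE mulrA. Qed.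

Lemma dotrNl {R : realType} {d : nat} (u w : 'rV[R]_d) :
  dotr (- u) w = - dotr u w.
Proof. by rewrite -scaleN1r dotrZl mulN1r. Qed.

Lemma dotrDr {R : realType} {d : nat} (u v w : 'rV[R]_d) :
  dotr w (u + v) = dotr w u + dotr w v.
Proof. by rewrite !(dotrC w) dotrDl. Qed.

Lemma dotrZr {R : realType} {d : nat} (a : R) (u w : 'rV[R]_d) :
  dotr w (a *: u) = a * dotr w u.
Proof. by rewrite !(dotrC w) dotrZl. Qed.

Lemma dotrNr {R : realType} {d : nat} (u w : 'rV[R]_d) :
  dotr w (- u) = - dotr w u.
Proof. by rewrite !(dotrC w) dotrNl. Qed.

Definition dotrE := (@dotrDl, @dotrDr, @dotrNl, @dotrNr, @dotrZl, @dotrZr).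

Lemma dotr_ge0 {R : realType} {d : nat} (u : 'rV[R]_d) : 0 <= dotr u u.
Proof. by apply: sumr_ge0 => i _; rewrite -expr2 sqr_ge0. Qed.

Lemma enorm_sqr {R : realType} {d : nat} (u : 'rV[R]_d) :
  enorm u ^+ 2 = dotr u u.
Proof.
rewrite sqr_sqrtr; first by apply: eq_bigr => i _; rewrite expr2.
by apply: sumr_ge0 => i _; rewrite sqr_ge0.
Qed.

(** The gradient is given by partial derivatives; differentiability makes it
represent the whole differential. *)
Lemma diff_gradient {R : realType} {d : nat} (f : 'rV[R]_d -> R)
    (x v : 'rV[R]_d) :
  differentiable f x -> 'd f x v = dotr (gradient f x) v.
Proof.
move=> df; rewrite [in LHS](row_sum_delta v) linear_sum; apply: eq_bigr => i _.
by rewrite linearZ/= mxE deriveE// /GRing.scale/= mulrC.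
Qed.

Lemma is_derive_sqdist {R : realType} {d : nat} {Z : R -> 'rV[R]_d}
    {v : 'rV[R]_d} {t : R} (c : 'rV[R]_d) :
  is_derive t 1 Z v ->
  is_derive t 1 (fun u => dotr (Z u - c) (Z u - c)) (2 * dotr (Z t - c) v).
Proof.
move=> [dZ Zv].
have dcoord i : is_derive t 1 (fun u => Z u 0 i - c 0 i) (v 0 i).
  have dZi : is_derive t 1 (fun u => Z u 0 i) (v 0 i).
    apply: DeriveDef; first exact: (derivable_mxP Z t 1).1.
    by rewrite -Zv (derive_mx dZ) mxE.
  apply: is_derive_eq (is_deriveB dZi (is_derive_cst (c 0 i) t 1)) _.
  by rewrite subr0.
have -> : (fun u => dotr (Z u - c) (Z u - c)) =
    \sum_(i < d) ((fun u => Z u 0 i - c 0 i) * (fun u => Z u 0 i - c 0 i)).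
  apply/funext => u; rewrite fct_sumE; apply: eq_bigr => i _.
  by rewrite !mxE.
apply: is_derive_eq (is_derive_sum (fun i => is_deriveM (dcoord i) (dcoord i))) _.
rewrite /dotr mulr_sumr; apply: eq_bigr => i _; rewrite !mxE /GRing.scale/=.
by ring.
Qed.

(** * Strong convexity *)

(** Strong convexity on the segment from [x] to [y], divided by [a]. Letting
[a] tend to [0] in this one inequality gives both the gradient inequality and
the quadratic growth at a minimizer. *)
Lemma strongly_convex_quotient_le {R : realType} {d : nat} {mu : R}
    {f : 'rV[R]_d -> R} (x y : 'rV[R]_d) (a : R) :
  strongly_convex mu f -> 0 < a -> a <= 1 ->
  a^-1 * (f (x + a *: (y - x)) - f x) <=
  f y - f x - mu / 2 * dotr (y - x) (y - x) * (1 - a).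
Proof.
move=> fconv a0 a1; have := fconv y x a (ltW a0) a1.
have -> : a *: y + (1 - a) *: x = x + a *: (y - x).
  by rewrite scalerBl scalerBr scale1r addrCA addrA.
rewrite enorm_sqr => h.
by rewrite -(ler_pM2l a0) mulrA divff ?gt_eqF// mul1r; lra.
Qed.

Lemma affine_cvg_right0 {R : realType} (c k : R) :
  c - k * (1 - a) @[a --> 0^'+] --> c - k.
Proof.
apply: cvg_at_right_filter; rewrite -[X in _ --> c - X]mulr1.
rewrite -[X in _ --> c - k * X](subr0 1).
apply: cvgB; first exact: cvg_cst.
apply: cvgM; first exact: cvg_cst.
by apply: cvgB; [exact: cvg_cst | exact: cvg_id].
Qed.

Lemma cvg_dnbhs_at_right {R : realType} {T : topologicalType} {F : R -> T}
    {x : R} {l : T} :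
  F h @[h --> x^'] --> l -> F h @[h --> x^'+] --> l.
Proof.
apply: cvg_trans; apply: cvg_app; apply: within_subset => h /=.
by rewrite lt_neqAle eq_sym => /andP[].
Qed.

(** The directional derivative is the limit of the difference quotients bounded
by [strongly_convex_quotient_le]. *)
Lemma strongly_convex_gradient_le {R : realType} {d : nat} {mu : R}
    {f : 'rV[R]_d -> R} (x y : 'rV[R]_d) :
  strongly_convex mu f -> differentiable f x ->
  dotr (gradient f x) (y - x) <=
  f y - f x - mu / 2 * dotr (y - x) (y - x).
Proof.
move=> fconv df; rewrite -diff_gradient// -deriveE//.
have slope_cvg := cvg_dnbhs_at_right (diff_derivable (v := y - x) df).
apply: (ler_cvg_to slope_cvg (affine_cvg_right0 _ _)); near=> a.
rewrite /= (addrC _ x); apply: strongly_convex_quotient_le => //.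
by near: a; exact: nbhs_right_le.
Unshelve. all: by end_near. Qed.

(** The difference quotients at a minimizer are nonnegative, so the right-hand
side of [strongly_convex_quotient_le] stays nonnegative as [a] tends to [0]. *)
Lemma minimizer_gap_ge {R : realType} {d : nat} {mu : R}
    {f : 'rV[R]_d -> R} (xs x : 'rV[R]_d) :
  strongly_convex mu f -> minimizer f xs ->
  mu / 2 * dotr (x - xs) (x - xs) <= f x - f xs.
Proof.
move=> fconv fmin; rewrite -subr_ge0.
apply: (ler_cvg_to (cvg_cst 0) (affine_cvg_right0 _ _)); near=> a.
apply: le_trans (strongly_convex_quotient_le _ _ _ fconv _ _) => //.
  by rewrite mulr_ge0 ?invr_ge0// subr_ge0; exact: fmin.
by near: a; exact: nbhs_right_le.
Unshelve. all: by end_near. Qed.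

(** * Eliminating the auxiliary curve *)

Lemma is_derive_gradient_comp {R : realType} {d : nat} {f : 'rV[R]_d -> R}
    {Z : R -> 'rV[R]_d} {t : R} {v : 'rV[R]_d} :
  differentiable (gradient f) (Z t) -> is_derive t 1 Z v ->
  is_derive t 1 (fun u => gradient f (Z u)) (v *m hessian f (Z t)).
Proof.
by move=> dg dZ; rewrite mul_rV_lin1; exact: is_derive_curve_comp.
Qed.

(** The velocity is an explicit function of [(X, V)], hence differentiable along
the trajectory; its derivative involves [V'], and both [V'] and [V] are then
expressed through [X] and [X']. *)
Lemma first_order_second_order {R : realType} {d : nat} {f : 'rV[R]_d -> R}
    {mu s : R} {X V : R -> 'rV[R]_d} :
  0 < mu -> 0 < s -> (forall x, differentiable (gradient f) x) ->
  first_order_system f (Num.sqrt s) (2 * Num.sqrt mu) (1 / Num.sqrt mu)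
    (Num.sqrt mu) X V ->
  second_order_ODE f mu s X.
Proof.
move=> mu0 s0 dg sys; rewrite /second_order_ODE sqrtrM ?ltW//.
have q0 : Num.sqrt mu != 0 by rewrite gt_eqF// sqrtr_gt0.
move: (Num.sqrt mu) (Num.sqrt s) q0 sys => q m q0 sys.
pose vel (x v : 'rV[R]_d) := - (m *: gradient f x) - (2 * q) *: (x - v).
have [Z [ZX dZ]] := has_time_derivative_extend (fun t t0 => (sys t t0).1).
have [W [WV dW]] := has_time_derivative_extend (fun t t0 => (sys t t0).2).
exists (fun t => vel (X t) (V t)), (fun t =>
  - (m *: (vel (X t) (V t) *m hessian f (X t))) - (2 * q) *: (vel (X t) (V t) -
    (- ((1 / q) *: gradient f (X t)) - q *: (V t - X t)))) => t t0.
split; first exact: (sys t t0).1.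
  apply: (has_time_derivative_restrict (Z := fun u => vel (Z u) (W u)) _ t0).
    by move=> u u0; rewrite ZX// WV.
  have := is_derive_gradient_comp (dg (Z t)) (dZ t t0); rewrite ZX// => dgZ.
  exact: is_deriveB (is_deriveN (is_deriveZ m dgZ))
    (is_deriveZ (2 * q) (is_deriveB (dZ t t0) (dW t t0))).
move: (_ *m _) => h; rewrite /vel.
move: (gradient f (X t)) => g; apply/rowP => i; rewrite !mxE.
by field.
Qed.

(** The first equation of the system dictates
[V = X + (X' + sqrt s *: grad f X) / (2 sqrt mu)], and with this choice it holds
identically; the second equation is the second-order equation divided by
[2 sqrt mu]. *)
Lemma second_order_first_order {R : realType} {d : nat} {f : 'rV[R]_d -> R}
    {mu s : R} {X : R -> 'rV[R]_d} :
  0 < mu -> 0 < s -> (forall x, differentiable (gradient f) x) ->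
  second_order_ODE f mu s X ->
  exists V, first_order_system f (Num.sqrt s) (2 * Num.sqrt mu)
    (1 / Num.sqrt mu) (Num.sqrt mu) X V.
Proof.
move=> mu0 s0 dg [X' [X'' ode]].
have q0 : Num.sqrt mu != 0 by rewrite gt_eqF// sqrtr_gt0.
move: ode; rewrite sqrtrM ?ltW//.
move: (Num.sqrt mu) (Num.sqrt s) q0 => q m q0 ode.
have dX (t : R) : 0 <= t -> has_time_derivative X t (X' t) by move=> /ode[].
have dX' (t : R) : 0 <= t -> has_time_derivative X' t (X'' t) by move=> /ode[].
have [Z [ZX dZ]] := has_time_derivative_extend dX.
have [Z' [ZX' dZ']] := has_time_derivative_extend dX'.
pose aux (x x' : 'rV[R]_d) := x + (2 * q)^-1 *: (x' + m *: gradient f x).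
exists (fun t => aux (X t) (X' t)) => t t0; split.
  have -> // : - (m *: gradient f (X t)) - (2 * q) *: (X t - aux (X t) (X' t))
    = X' t.
    rewrite /aux; move: (gradient f (X t)) => g; apply/rowP => i; rewrite !mxE.
    by field.
  exact: dX.
apply: (has_time_derivative_restrict (Z := fun u => aux (Z u) (Z' u)) _ t0).
  by move=> u u0; rewrite ZX// ZX'.
have := is_derive_gradient_comp (dg (Z t)) (dZ t t0); rewrite ZX// => dgZ.
apply: is_derive_eq (is_deriveD (dZ t t0) (is_deriveZ (2 * q)^-1
  (is_deriveD (dZ' t t0) (is_deriveZ m dgZ)))) _.
have [_ _] := ode t t0; rewrite /aux.
move: (_ *m _) (gradient f (X t)) => h g ode_t.
apply/rowP => i; move/rowP/(_ i): ode_t; rewrite !mxE => ode_t.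
have -> : X'' t 0 i = - (3 * q * X' t 0 i + m * h 0 i
    + (2 + m * q) * g 0 i) by rewrite -[LHS]subr0 -ode_t; ring.
by field.
Qed.

(** * Decay estimates *)

(** With [x], [v], [g], [q] as in the introduction and [h = f X - f xs -
mu/2 |x|^2], the derivative of the energy is exactly
[- m (|g|^2 - mu <g, x>) - 2 q (<g, x> - mu |x|^2) - 2 q mu |v|^2]. The first
bracket is [|g - mu x|^2 + mu (<g, x> - mu |x|^2)], and the gradient inequality
says [<g, x> - mu |x|^2 >= h >= 0]; so the [m] term can be dropped and the
middle one bounded by [- 2 q h]. *)
Lemma energy_decay {R : realType} {d : nat} {mu m : R} {f : 'rV[R]_d -> R}
    {xs : 'rV[R]_d} {X V : R -> 'rV[R]_d} :
  0 < mu -> 0 <= m -> strongly_convex mu f -> minimizer f xs ->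
  (forall x, differentiable f x) ->
  (forall t : R, 0 <= t -> is_derive t 1 X
    (- (m *: gradient f (X t)) - (2 * Num.sqrt mu) *: (X t - V t))) ->
  (forall t : R, 0 <= t -> is_derive t 1 V
    (- ((1 / Num.sqrt mu) *: gradient f (X t)) - Num.sqrt mu *: (V t - X t))) ->
  let E t := f (X t) - f xs - mu / 2 * dotr (X t - xs) (X t - xs)
             + mu * dotr (V t - xs) (V t - xs) in
  forall t : R, 0 <= t -> E t <= E 0 * expR (- (2 * Num.sqrt mu * t)).
Proof.
move=> mu0 m0 fconv fmin df dX dV E.
have q0 : 0 < Num.sqrt mu by rewrite sqrtr_gt0.
have qE : mu = Num.sqrt mu ^+ 2 by rewrite sqr_sqrtr// ltW.
set q := Num.sqrt mu in q0 qE dX dV *.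
pose X' t := - (m *: gradient f (X t)) - (2 * q) *: (X t - V t).
pose V' t := - ((1 / q) *: gradient f (X t)) - q *: (V t - X t).
have dE (t : R) (t0 : 0 <= t) : is_derive t 1 E
    (dotr (gradient f (X t)) (X' t) - mu / 2 * (2 * dotr (X t - xs) (X' t))
     + mu * (2 * dotr (V t - xs) (V' t))).
  rewrite -diff_gradient// -['d f _ _]subr0.
  exact: is_deriveD (is_deriveB
    (is_deriveB (is_derive_curve_comp (df (X t)) (dX t t0)) (is_derive_cst _ _ _))
    (is_deriveZ (mu / 2) (is_derive_sqdist xs (dX t t0))))
    (is_deriveZ mu (is_derive_sqdist xs (dV t t0))).
apply: (gronwall dE) => t t0; rewrite /E /X' /V'.
have gap := minimizer_gap_ge xs (X t) fconv fmin.
have := strongly_convex_gradient_le (X t) xs fconv (df (X t)).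
rewrite -(opprB (X t) xs).
have -> : X t - V t = (X t - xs) - (V t - xs) by rewrite opprB addrA subrK.
have -> : V t - X t = (V t - xs) - (X t - xs) by rewrite opprB addrA subrK.
move: (gradient f (X t)) (X t - xs) (V t - xs) gap => g x v gap.
rewrite !(dotrNl, dotrNr) opprK => grad_le.
have gx_ge0 : 0 <= dotr (g - mu *: x) (g - mu *: x) := dotr_ge0 _.
have : 0 <= m * (dotr g g - mu * dotr g x).
  rewrite mulr_ge0//.
  have : 0 <= mu * (dotr g x - mu * dotr x x) by rewrite mulr_ge0 ?(ltW mu0, ltW q0)//; lra.
  by move: gx_ge0; rewrite !dotrE (dotrC x g); lra.
have : 0 <= q * (dotr g x - mu / 2 * dotr x x - (f (X t) - f xs)).
  by rewrite mulr_ge0 ?(ltW mu0, ltW q0)//; lra.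
rewrite !dotrE (dotrC v g) (dotrC x g) (dotrC v x).
(* q is a square root of mu, so mu / q = q: the terms in <g, v> cancel. *)
have -> : mu * (2 * (- (1 / q * dotr g v) - q * (dotr v v - dotr x v))) =
    - (2 * q * dotr g v) - 2 * q * mu * (dotr v v - dotr x v).
  by rewrite qE; field; rewrite gt_eqF.
by lra.
Qed.

(** The field [g] only pushes towards [xs], so its term has a favourable sign.
Young's inequality [4 q <x, v> <= q |x|^2 + 4 q |v|^2], with [x = X - xs] and
[v = V - xs], gives [(|x|^2)' <= - 3 q |x|^2 + 4 q K exp (- 2 q t)]. The function
[4 K exp (- 2 q t)] solves the equation with equality, so subtracting it leaves
a quantity that decays at rate [3 q]. Absorbing the cross term with coefficient
[2 q] instead would leave damping [2 q], in resonance with the forcing. *)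
Lemma position_decay {R : realType} {d : nat} {q m K : R}
    {g : 'rV[R]_d -> 'rV[R]_d} {xs : 'rV[R]_d} {X V : R -> 'rV[R]_d} :
  0 < q -> 0 <= m -> 0 <= K ->
  (forall x, 0 <= dotr (g x) (x - xs)) ->
  (forall t : R, 0 <= t -> is_derive t 1 X
    (- (m *: g (X t)) - (2 * q) *: (X t - V t))) ->
  (forall t : R, 0 <= t ->
    dotr (V t - xs) (V t - xs) <= K * expR (- (2 * q * t))) ->
  forall t : R, 0 <= t -> dotr (X t - xs) (X t - xs) <=
    (dotr (X 0 - xs) (X 0 - xs) + 4 * K) * expR (- (2 * q * t)).
Proof.
move=> q0 m0 K0 g_mono dX V_decay t t0.
pose A t := dotr (X t - xs) (X t - xs) - 4 * K * expR (- (2 * q) * t).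
pose X' t := - (m *: g (X t)) - (2 * q) *: (X t - V t).
have dA (u : R) (u0 : 0 <= u) : is_derive u 1 A
    (2 * dotr (X u - xs) (X' u)
     - 4 * K * (expR (- (2 * q) * u) * - (2 * q))).
  exact: is_deriveB (is_derive_sqdist xs (dX u u0))
    (is_deriveZ (4 * K) (is_derive_expRM _ u)).
have A_decay : A t <= A 0 * expR (- (3 * q * t)).
  apply: (gronwall dA) => // u u0; rewrite /A /X'.
  have := V_decay u u0; rewrite -mulNr; move: (expR _) => e.
  have := g_mono (X u).
  have -> : X u - V u = (X u - xs) - (V u - xs) by rewrite opprB addrA subrK.
  move: (g (X u)) (X u - xs) (V u - xs) => h x v hx_ge0 v_le.
  (* Young's inequality, as the nonnegativity of |x - 2 v|^2. *)
  have : 0 <= q * dotr (x - 2 *: v) (x - 2 *: v).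
    by rewrite mulr_ge0 ?(ltW q0) ?dotr_ge0.
  have : 0 <= q * (K * e - dotr v v) by rewrite mulr_ge0 ?(ltW q0)//; lra.
  have : 0 <= m * dotr h x by rewrite mulr_ge0.
  rewrite !dotrE (dotrC v x) (dotrC x h).
  by lra.
have A0_le : A 0 <= dotr (X 0 - xs) (X 0 - xs).
  by rewrite /A mulr0 expR0; lra.
have exp_le : expR (- (3 * q * t)) <= expR (- (2 * q * t)).
  have : 0 <= q * t by rewrite mulr_ge0 ?(ltW q0).
  by rewrite ler_expR; lra.
have : A 0 * expR (- (3 * q * t)) <=
    dotr (X 0 - xs) (X 0 - xs) * expR (- (2 * q * t)).
  apply: le_trans (ler_wpM2r (expR_ge0 _) A0_le) _.
  exact: ler_wpM2l (dotr_ge0 _) _ _ exp_le.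
by move: A_decay; rewrite {1}/A mulNr; lra.
Qed.

Theorem corollary1 (R : realType) (d : nat) (mu L s : R)
    (f : 'rV[R]_d -> R) (xs : 'rV[R]_d)
    (hmu : 0 < mu) (hmuL : mu <= L) (hf : F_class mu L f)
    (hxs : minimizer f xs) (hs : 0 < s) (hsL : s <= 1 / L)
    (m q n p : R) (hm : m = Num.sqrt s) (hq : q = Num.sqrt mu)
    (hn : n = 2 * Num.sqrt mu) (hp : p = 1 / Num.sqrt mu) :
  (twice_continuously_differentiable f ->
     forall X : R -> 'rV[R]_d,
       (exists V : R -> 'rV[R]_d, first_order_system f m n p q X V) <->
       second_order_ODE f mu s X) /\
  (forall x0 v0 : 'rV[R]_d, exists C : R, 0 < C /\
     forall X V : R -> 'rV[R]_d,
       first_order_system f m n p q X V -> X 0 = x0 -> V 0 = v0 ->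
       forall t : R, 0 <= t ->
         f (X t) - f xs <= C * expR (- (2 * Num.sqrt mu * t))).
Proof.
have [fconv [df _]] := hf; subst m q n p.
split=> [[_ dg _] X|x0 v0].
  split=> [[V]|]; first exact: first_order_second_order.
  exact: second_order_first_order.
have q0 : 0 < Num.sqrt mu by rewrite sqrtr_gt0.
have gap x := minimizer_gap_ge xs x fconv hxs.
have g_mono x : 0 <= dotr (gradient f x) (x - xs).
  have := strongly_convex_gradient_le x xs fconv (df x).
  rewrite -(opprB x xs) !(dotrNl, dotrNr).
  have : 0 <= mu / 2 * dotr (x - xs) (x - xs).
    by rewrite !mulr_ge0 ?dotr_ge0 ?(ltW hmu).
  by have := hxs x; lra.
pose E0 := f x0 - f xs - mu / 2 * dotr (x0 - xs) (x0 - xs)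
           + mu * dotr (v0 - xs) (v0 - xs).
pose D0 := dotr (x0 - xs) (x0 - xs).
have E0_ge0 : 0 <= E0.
  by rewrite addr_ge0 ?subr_ge0// mulr_ge0 ?dotr_ge0 ?(ltW hmu).
(* E0 bounds the energy and mu / 2 times the position bound, with K = E0 / mu,
   restores the quadratic term; 1 only makes the constant positive. *)
exists (1 + E0 + mu / 2 * (D0 + 4 * (E0 / mu))); split.
  rewrite ltr_wpDr// ?ltr_wpDr// mulr_ge0 ?divr_ge0 ?(ltW hmu)//.
  by rewrite addr_ge0 ?dotr_ge0// mulr_ge0// divr_ge0 ?(ltW hmu).
move=> X V sys X0 V0 t t0.
have [Z [ZX dZ]] := has_time_derivative_extend (fun t t0 => (sys t t0).1).
have [W [WV dW]] := has_time_derivative_extend (fun t t0 => (sys t t0).2).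
have {}dZ (u : R) : 0 <= u -> is_derive u 1 Z
    (- (Num.sqrt s *: gradient f (Z u)) - (2 * Num.sqrt mu) *: (Z u - W u)).
  by move=> u0; rewrite ZX// WV//; exact: dZ.
have {}dW (u : R) : 0 <= u -> is_derive u 1 W
    (- ((1 / Num.sqrt mu) *: gradient f (Z u)) - Num.sqrt mu *: (W u - Z u)).
  by move=> u0; rewrite ZX// WV//; exact: dW.
have E_decay := energy_decay hmu (sqrtr_ge0 s) fconv hxs df dZ dW.
have Z0 : Z 0 = x0 by rewrite ZX.
have W0 : W 0 = v0 by rewrite WV.
have W_decay (u : R) : 0 <= u ->
    dotr (W u - xs) (W u - xs) <= E0 / mu * expR (- (2 * Num.sqrt mu * u)).
  move=> /E_decay; rewrite Z0 W0 -/E0 => E_le.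
  rewrite mulrAC ler_pdivlMr// mulrC; have := gap (Z u); lra.
have Z_decay := position_decay q0 (sqrtr_ge0 s) (divr_ge0 E0_ge0 (ltW hmu))
  g_mono dZ W_decay t t0.
have := E_decay t t0; move: Z_decay; rewrite Z0 W0 -/E0 -/D0 (ZX t)//.
rewrite -(ler_pM2l (divr_gt0 hmu (ltr0n _ 2))).
have : 0 <= mu * dotr (W t - xs) (W t - xs).
  by rewrite mulr_ge0 ?dotr_ge0 ?(ltW hmu).
have := expR_ge0 (- (2 * Num.sqrt mu * t)).
move: (expR _) => e e0; rewrite [in X in _ -> X]mulrA; lra.
Qed.
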